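(* Let $1\le k\le m$ and let $\nu$ be any permutation of $[k]$. Then: (1) $W_\nu^m(x)=x$ for all $x\in S_{k,m}$. (2) The orbit structure of $W_\nu$ on $S_{k,m}$ equals the orbit structure of cyclic rotation $A\mapsto\{v+1 \bmod m: v\in A\}$ (residues taken in $\{1,\dots,m\}$) acting on the $k$-element subsets of $[m]$ (equivalently, of rotation on 2-colored necklaces with $k$ white and $m-k$ black beads); in particular it does not depend on $\nu$. (3) For $1\le i\le k$, $1\le j\le m$ let $g_{i,j}(x)=1$ if $x_i=j$ and $0$ otherwise. Then each $d_{i,j}=g_{i,j}-g_{k+1-i,\,m+1-j}$ is $0$-mesic for $W_\nu$ on $S_{k,m}$. For $1\le j\le m$ let $f_j(x)=1$ if $j\in\{x_1,\dots,x_k\}$ and $0$ otherwise; then $f_j$ is homomesic for $W_\nu$ on $S_{k,m}$ with average $k/m$ along every orbit. Hence any real linear combination of the $d_{i,j}$ and $f_j$ is homomesic.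
   Context: $S_{k,m}$ is the set of integer $k$-tuples $x=(x_1,\dots,x_k)$ with $0<x_1<\dots<x_k<m+1$. Winching on index $i$: $W_i(x)=y$ with $y_j=x_j$ for $j\ne i$, $y_i=x_i+1$ if $x_i+1<x_{i+1}$, and $y_i=x_{i-1}+1$ otherwise, with conventions $x_0=0$, $x_{k+1}=m+1$. For a permutation $\nu$ of $[k]$, $W_\nu=W_{\nu(k)}\circ W_{\nu(k-1)}\circ\cdots\circ W_{\nu(1)}$. A function on a finite set with a permutation $\tau$ is homomesic if its average over every $\tau$-orbit is the same constant, and $0$-mesic if that constant is $0$. *)

(* Defs.v *)
From HB Require Import structures.
From mathcomp Require Import all_boot all_order all_fingroup all_algebra.
Set Implicit Arguments. Unset Strict Implicit. Unset Printing Implicit Defensive.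
Import Order.TTheory GRing.Theory Num.Theory.

(* Carrier: functions 'I_k -> 'I_(m+2); x i is the (i+1)-st coordinate
   x_{i+1} (0-based position i, 1-based coordinate i+1). *)
Definition tup (k m : nat) := {ffun 'I_k -> 'I_m.+2}.

Definition Skm (k m : nat) : {set tup k m} :=
  [set x : tup k m | [&& [forall i : 'I_k, 0 < x i], [forall i : 'I_k, x i <= m]
                       & [forall i : 'I_k, forall j : 'I_k, (i < j)%N ==> (x i < x j)%N]]].

(* x_j for 1-based j in 0..k+1, with x_0 = 0 and x_{k+1} = m+1 *)
Definition xs (k m : nat) (x : tup k m) (j : nat) : nat :=
  if j == 0 then 0
  else if j <= k then nth 0 [seq val (x i) | i <- enum 'I_k] j.-1
  else m.+1.

(* Winching on the coordinate with 0-based position i (1-based index i+1). *)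
Definition winch (k m : nat) (i : 'I_k) (x : tup k m) : tup k m :=
  [ffun j => if j == i then
      inord (if (xs x i.+1).+1 < xs x i.+2 then (xs x i.+1).+1
             else (xs x i).+1)
    else x j].

Definition Wnu (k m : nat) (nu : 'S_k) (x : tup k m) : tup k m :=
  foldl (fun y t => winch (nu t) y) x (enum 'I_k).

(* Elements of [m] = {1..m} are represented by 'I_m, i : 'I_m standing for i+1.
   Cyclic rotation v |-> v+1 mod m (residues in {1..m}) is then ordS. *)
Definition rotm (m : nat) (A : {set 'I_m}) : {set 'I_m} := [set ordS i | i in A].

Definition ksubsets (k m : nat) : {set {set 'I_m}} := [set A : {set 'I_m} | #|A| == k].

Definition orbit_avg (R : numFieldType) (T : finType) (tau : T -> T) (F : T -> R) (x : T) : R :=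
  ((\sum_(y <- fingraph.orbit tau x) F y) / (size (fingraph.orbit tau x))%:R)%R.

Definition homomesic (R : numFieldType) (T : finType) (tau : T -> T) (S : {set T}) (F : T -> R) :=
  exists c : R, forall x, x \in S -> orbit_avg tau F x = c.

Definition zero_mesic (R : numFieldType) (T : finType) (tau : T -> T) (S : {set T}) (F : T -> R) :=
  forall x, x \in S -> orbit_avg tau F x = 0%R.

Definition gfun (R : numFieldType) (k m : nat) (i : 'I_k) (j : nat) (x : tup k m) : R :=
  ((val (x i) == j)%:R)%R.

(* d_{i+1,j} = g_{i+1,j} - g_{k-i, m+1-j}; rev_ord i has 0-based position k-1-i *)
Definition dfun (R : numFieldType) (k m : nat) (i : 'I_k) (j : nat) (x : tup k m) : R :=
  (gfun R i j x - gfun R (rev_ord i) (m.+1 - j) x)%R.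

Definition ffn (R : numFieldType) (k m : nat) (j : nat) (x : tup k m) : R :=
  (([exists i, val (x i) == j])%:R)%R.

(* Main.v *)
(** If coordinate [i + 1] moves just before coordinate [i] for every [i], then a
    coordinate is blocked exactly when its right neighbour has just been reset,
    so in one round either all coordinates are reset or none is: winching in the
    order k, ..., 1 rotates the set of values cyclically.  In an arbitrary order
    two adjacent coordinates still move alternately, so reading each coordinate
    with a suitable fixed delay reproduces the order k, ..., 1.  The delayed
    tuple therefore conjugates W_nu to rotation, which gives (1) and (2).  Since
    a delay does not change sums over a period, the averages in (3) may be
    computed for rotation: there, the i-th element after j rotations is at most
    j iff the i-th element from the top was initially greater than m - j. *)
Require Import Defs.
From HB Require Import structures.
From mathcomp Require Import all_boot all_order all_fingroup all_algebra.
From mathcomp Require Import zify.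
Import Order.TTheory GRing.Theory Num.Theory.
Set Implicit Arguments. Unset Strict Implicit. Unset Printing Implicit Defensive.

(** * Sums of periodic sequences and averages over orbits *)

Section PeriodicSums.
Local Open Scope ring_scope.

Lemma sum_periodic_shift (V : nmodType) (g : nat -> V) (n s : nat) :
  (forall t, g (t + n)%N = g t) -> \sum_(t < n) g (t + s)%N = \sum_(t < n) g t.
Proof.
move=> gn; elim: s => [|s IH]; first by under eq_bigr do rewrite addn0.
rewrite -IH; case: n gn {IH} => [|n] gn; first by rewrite !big_ord0.
rewrite big_ord_recr big_ord_recl /= addrC -{1}addSnnS addnC gn add0n.
by congr (_ + _); apply: eq_bigr => t _; rewrite addnS.
Qed.

Lemma sum_periodic_mul (V : nmodType) (g : nat -> V) (n q : nat) :
  (forall t, g (t + n)%N = g t) -> \sum_(t < q * n) g t = (\sum_(t < n) g t) *+ q.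
Proof.
move=> gn; elim: q => [|q IH]; first by rewrite big_ord0.
rewrite mulSn big_split_ord mulrS -IH; congr (_ + _).
by apply: eq_bigr => t _; rewrite /= addnC gn.
Qed.

(** Any positive period [n] may replace the orbit length: a sum over [n] times the orbit length
    steps splits into whole blocks of either size. *)
Lemma orbit_avg_period (R : numFieldType) (T : finType) (tau : T -> T) (F : T -> R) n x :
  (0 < n)%N -> iter n tau x = x ->
  orbit_avg tau F x = (\sum_(t < n) F (iter t tau x)) / n%:R.
Proof.
case: n => // n _ xn; rewrite /orbit_avg fingraph.size_orbit.
have xo : iter (fingraph.order tau x) tau x = x.
  (* Item 3 of the equivalences says that some positive iterate fixes [x], item 4 that the iterate
     by the orbit length does. *)
  by apply/(@orbitPcycle _ tau x 3 4); exists n.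
have o0 : (fingraph.order tau x)%:R != 0 :> R by rewrite pnatr_eq0 -lt0n fingraph.order_gt0.
rewrite (big_nth x) fingraph.size_orbit big_mkord.
under eq_bigr => t _ do rewrite nth_traject //.
set g := fun t => F (iter t tau x).
have per p : iter p tau x = x -> forall t, g (t + p)%N = g t.
  by move=> xp t; rewrite /g iterD xp.
apply/eqP; rewrite eqr_div //; last by rewrite pnatr_eq0.
rewrite !mulr_natr -(sum_periodic_mul _ (per _ xo)) -(sum_periodic_mul _ (per _ xn)).
by rewrite mulnC.
Qed.
End PeriodicSums.

(** * Cyclic rotation of subsets of [m] *)

Section Rotation.
Variable m : nat.
Implicit Type A : {set 'I_m}.

Lemma val_iter_ordS t (a : 'I_m) : iter t (@ordS m) a = (a + t) %% m :> nat.
Proof.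
elim: t => [|t IH] /=; first by rewrite addn0 modn_small.
by rewrite IH -addn1 modnDml addn1 addnS.
Qed.

Lemma iter_ordS_inj t : injective (iter t (@ordS m)).
Proof. by elim: t => //= t IH a b /ordS_inj /IH. Qed.

Lemma iter_rotm t A : iter t (@rotm m) A = [set iter t (@ordS m) a | a in A].
Proof.
elim: t => [|t IH] /=; first by rewrite imset_id.
by rewrite IH /rotm -imset_comp.
Qed.

Lemma iter_rotm_period A : iter m (@rotm m) A = A.
Proof.
rewrite iter_rotm -[RHS]imset_id; apply: eq_imset => a /=.
by apply: val_inj; rewrite /= val_iter_ordS modnDr modn_small.
Qed.

(** A 0-based value lands below [j] after [j] rotations exactly when it wraps around, that is, when
    it started at [m - j] or higher. *)
Lemma card_iter_rotm_lt j A : j <= m ->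
  #|[set v in iter j (@rotm m) A | v < j]| = #|A| - #|[set v in A | v < m - j]|.
Proof.
move=> jm; have -> : [set v in A | v < m - j] = A :&: [set v : 'I_m | v < m - j].
  by apply/setP => v; rewrite !inE.
rewrite -cardsD -[RHS](card_imset _ (@iter_ordS_inj j)); congr #|pred_of_set _|.
have E (a : 'I_m) : ((a + j) %% m < j) = (m - j <= a).
  have am := ltn_ord a; case: (ltnP (a + j) m) => h; first by rewrite modn_small //; lia.
  by rewrite -(subnK h) modnDr modn_small; lia.
apply/setP => v; rewrite iter_rotm inE; apply/andP/imsetP.
  move=> [/imsetP[a aA ->]]; rewrite val_iter_ordS E => ja.
  by exists a; rewrite ?inE // -leqNgt ja.
move=> [a]; rewrite !inE -leqNgt => /andP[ja aA] ->.
by rewrite imset_f // val_iter_ordS E.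
Qed.

(** Each element of [A] visits [v] exactly once during [m] rotations. *)
Lemma sum_iter_rotm (R : pzSemiRingType) (v : 'I_m) A :
  (\sum_(t < m) (v \in iter t (@rotm m) A)%:R = #|A|%:R :> R)%R.
Proof.
have E t : ((v \in iter t (@rotm m) A)%:R =
            \sum_(a in A) ((t + a) %% m == v)%N%:R :> R)%R.
  rewrite iter_rotm; transitivity (\sum_(w in iter t (@ordS m) @: A) (w == v)%:R : R)%R.
    case: (boolP (v \in _)) => vB; last first.
      by rewrite big1 // => w wB; case: eqP => // e; rewrite -e wB in vB.
    by rewrite (bigD1 v) //= eqxx big1 ?addr0 // => w /andP[_ /negPf ->].
  rewrite big_imset /=; last exact: in2W (@iter_ordS_inj t).
  by apply: eq_bigr => a _; rewrite -val_eqE /= val_iter_ordS addnC.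
under eq_bigr do rewrite E.
rewrite exchange_big /= -sum1_card natr_sum; apply: eq_bigr => a _.
rewrite (sum_periodic_shift (g := fun t => (t %% m == v)%N%:R : R)%R) => [|t]; last first.
  by rewrite modnDr.
rewrite (bigD1 v) //= modn_small // eqxx big1 ?addr0 // => t.
by rewrite modn_small // -val_eqE => /negPf ->.
Qed.
End Rotation.

(** * Tuples and their value sets *)

Lemma card_ord_ltn n (k : nat) : n <= k -> #|[set i : 'I_k | i < n]| = n.
Proof.
move=> nk; rewrite -sum1_card (eq_bigl (fun i : 'I_k => i < n)).
  by rewrite -(big_ord_widen k (fun=> 1)) // sum_nat_const card_ord muln1.
by move=> i; rewrite inE.
Qed.

Section Values.
Variables k m : nat.
Implicit Types (x y : tup k m) (i : 'I_k).

Definition values x : {set 'I_m} := [set v : 'I_m | [exists i, val (x i) == v.+1]].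

Lemma Skm_bounds x i : x \in Skm k m -> 0 < x i <= m.
Proof. by rewrite inE => /and3P[/forallP/(_ i) -> /forallP/(_ i) ->]. Qed.

Lemma Skm_ltn_ord x i i' : x \in Skm k m -> i < i' -> x i < x i'.
Proof.
by rewrite inE => /and3P[_ _ /forallP/(_ i)/forallP/(_ i')/implyP h] /h.
Qed.

Lemma Skm_ord_inj x : x \in Skm k m -> injective x.
Proof.
move=> Sx i i' e; apply: val_inj.
case: (ltngtP i i') => // /(Skm_ltn_ord Sx); by rewrite e ltnn.
Qed.

Lemma card_values_lt x j : x \in Skm k m ->
  #|[set v in values x | v < j]| = #|[set i | x i <= j]|.
Proof.
move=> Sx; have b i : (x i).-1 < m by have := Skm_bounds i Sx; lia.
have hinj : injective (fun i => Ordinal (b i)).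
  move=> i i' [e]; apply: (Skm_ord_inj Sx); apply: val_inj => /=.
  by have := Skm_bounds i Sx; have := Skm_bounds i' Sx; lia.
rewrite -[RHS](card_imset _ hinj); congr #|pred_of_set _|; apply/setP => v.
rewrite !inE; apply/andP/imsetP => [[/existsP[i /eqP e] vj]|[i]].
  by exists i; [rewrite inE e | apply: val_inj; rewrite /= e].
rewrite inE => ij ->; have := Skm_bounds i Sx => ib.
by split; [apply/existsP; exists i; apply/eqP|]; rewrite /=; lia.
Qed.

Lemma card_values x : x \in Skm k m -> #|values x| = k.
Proof.
move=> Sx; have := card_values_lt m Sx.
rewrite (_ : [set v in _ | _] = values x); last first.
  by apply/setP => v; rewrite !inE ltn_ord andbT.
move=> ->; rewrite -[RHS]card_ord -cardsT; congr #|pred_of_set _|.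
by apply/setP => i; rewrite !inE; case/andP: (Skm_bounds i Sx).
Qed.

(** Since [x] increases, the positions with entry at most [j] form an initial segment, so its length
    decides whether it contains [i]. *)
Lemma Skm_le_card x i j : x \in Skm k m ->
  (x i <= j) = (i < #|[set v in values x | v < j]|).
Proof.
move=> Sx; rewrite card_values_lt //; have ik := ltn_ord i.
apply/idP/idP => [xij|].
  apply: leq_trans (eq_leq (esym (card_ord_ltn ik))) _; apply: subset_leq_card; apply/subsetP => i'.
  rewrite !inE ltnS leq_eqVlt => /orP[/eqP/val_inj -> //|/(Skm_ltn_ord Sx)]; lia.
apply: contraLR; rewrite -ltnNge -leqNgt => xij; rewrite -[X in _ <= X](card_ord_ltn (ltnW ik)).
apply: subset_leq_card; apply/subsetP => i'; rewrite !inE => xj.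
rewrite ltnNge leq_eqVlt; apply/negP => /orP[/eqP/val_inj e|/(Skm_ltn_ord Sx)]; last lia.
by move: xij; rewrite e ltnNge xj.
Qed.

Lemma values_inj : {in Skm k m &, injective values}.
Proof.
move=> x y Sx Sy e; apply/ffunP => i; apply: val_inj; apply/eqP.
have E j : (x i <= j) = (y i <= j) by rewrite !Skm_le_card // e.
by rewrite eqn_leq; apply/andP; split; [rewrite E | rewrite -E].
Qed.

Lemma imset_values : values @: Skm k m = ksubsets k m.
Proof.
apply/setP => A; rewrite inE; apply/imsetP/eqP => [[x Sx ->]|cA].
  exact: card_values.
(* [enum] lists [A] in increasing order, which gives the preimage tuple. *)
pose p := [seq val v | v <- enum A].
have szp : size p = k by rewrite size_map -cardE.
have pm i : nth 0 p i < m.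
  have /(mem_nth 0)/mapP[v _ ->] : i < size p by rewrite szp.
  exact: ltn_ord.
have ps : sorted ltn p.
  rewrite sorted_map /enum_mem sorted_filter //; first by move=> a b c; apply: ltn_trans.
  by have := iota_ltn_sorted 0 m; rewrite -val_enum_ord sorted_map enumT.
pose x : tup k m := [ffun i : 'I_k => inord (nth 0 p i).+1].
have xE i : val (x i) = (nth 0 p i).+1.
  by rewrite ffunE /= inordK // !ltnS ltnW // pm.
exists x.
  rewrite inE; apply/and3P; split; apply/forallP => i; rewrite ?xE ?pm //.
  apply/forallP => j; apply/implyP => ij; rewrite !xE ltnS.
  by apply: (sorted_ltn_nth ltn_trans 0 ps) => //; rewrite inE szp.
apply/setP => v; rewrite inE.
have -> : (v \in A) = (val v \in p) by rewrite mem_map ?mem_enum //; apply: val_inj.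
apply/idP/existsP => [vp|[i /eqP]]; last by rewrite xE => -[/= <-]; rewrite mem_nth ?szp.
have ik : index (val v) p < k by rewrite -szp index_mem.
by exists (Ordinal ik); rewrite xE /= nth_index.
Qed.

(* Rotating by [j] carries the last [j] positions onto the first [j]. *)
Lemma values_rot_rev x y i j : x \in Skm k m -> y \in Skm k m -> j <= m ->
  values y = iter j (@rotm m) (values x) -> (y i <= j) = (m - j < x (rev_ord i)).
Proof.
move=> Sx Sy jm e; rewrite Skm_le_card // e card_iter_rotm_lt // card_values //.
rewrite [RHS]ltnNge Skm_le_card //= -leqNgt; have := ltn_ord i; lia.
Qed.
End Values.

(** * Winching in coordinates extended by the two sentinels *)

Section Coordinates.
Variables k m : nat.
Implicit Types (x y : tup k m) (i : 'I_k).

Lemma xs0 x : xs x 0 = 0. Proof. by []. Qed.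

Lemma xs_last x j : k < j -> xs x j = m.+1.
Proof. by rewrite /xs; case: j => // j kj; rewrite leqNgt kj. Qed.

Lemma xs_ord x i : xs x i.+1 = x i.
Proof.
rewrite /xs /= ltn_ord (nth_map i) ?size_enum_ord ?ltn_ord //.
by rewrite nth_ord_enum.
Qed.

Lemma xs_ordP (P : nat -> Prop) :
  P 0 -> (forall i, P i.+1) -> (forall j, k < j -> P j) -> forall j, P j.
Proof.
move=> P0 Pi Pk [|j] //; case: (ltnP j k) => [jk|kj]; last exact: (Pk j.+1 kj).
exact: (Pi (Ordinal jk)).
Qed.

Lemma xs_inj x y : (forall j, xs x j = xs y j) -> x = y.
Proof. by move=> e; apply/ffunP => i; apply: val_inj; rewrite /= -!xs_ord e. Qed.

Lemma xs_ltn x : (forall j, j <= k -> xs x j < xs x j.+1) ->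
  forall l j, l < j <= k.+1 -> xs x l < xs x j.
Proof.
move=> h l; elim=> [|j IH] // /andP[ij jk].
case: (ltngtP l j) => [lij|lij|->]; [|lia|exact: h].
by apply: ltn_trans (IH _) (h _ _); lia.
Qed.

(** The sentinels absorb the bounds 0 and m+1, so membership becomes a condition on adjacent entries
    only. *)
Lemma SkmP x : reflect (forall j, j <= k -> xs x j < xs x j.+1) (x \in Skm k m).
Proof.
rewrite inE; apply: (iffP and3P) => [[/forallP p0 /forallP pm /forallP pl] j jk|h].
  case: j jk => [|j] jk.
    case: (posnP k) => [k0|k0]; first by rewrite xs0 xs_last ?k0.
    by rewrite (xs_ord x (Ordinal k0)).
  rewrite (xs_ord x (Ordinal jk)).
  case: (ltnP j.+1 k) => [jk1|jk1]; last by rewrite xs_last ?ltnS.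
  rewrite (xs_ord x (Ordinal jk1)).
  by have /forallP/(_ (Ordinal jk1))/implyP := pl (Ordinal jk); apply => /=.
have H := xs_ltn h.
split; apply/forallP => i; have ik := ltn_ord i.
- by have := H 0 i.+1; rewrite xs_ord xs0; apply; lia.
- by have := H i.+1 k.+1; rewrite xs_ord xs_last //; apply; lia.
apply/forallP => j; apply/implyP => ij; have jk := ltn_ord j.
by have := H i.+1 j.+1; rewrite !xs_ord; apply; lia.
Qed.

Lemma Skm_ltn x l j : x \in Skm k m -> l < j <= k.+1 -> xs x l < xs x j.
Proof. by move/SkmP/xs_ltn; apply. Qed.

(** The arguments are the current, left and right entries. Separating them from the tuple allows
    neighbours taken from different rounds. *)
Definition winch_val (c l r : nat) := if c.+1 < r then c.+1 else l.+1.

Lemma xs_winch i x j : x \in Skm k m -> xs (winch i x) j =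
  if j == i.+1 then winch_val (xs x j) (xs x j.-1) (xs x j.+1) else xs x j.
Proof.
move=> Sx; elim/xs_ordP: j => [|j|j kj] //.
  rewrite xs_ord ffunE eqSS (inj_eq val_inj); case: eqP => [->|_]; last by rewrite xs_ord.
  (* The new entry is at most m+1, so [inord] never returns its default. *)
  rewrite inordK /winch_val /=; first by [].
  have ik := ltn_ord i.
  have := @Skm_ltn x i k.+1 Sx; have := @Skm_ltn x i.+1 k.+1 Sx.
  by rewrite (@xs_last x k.+1) //; case: ifP; lia.
by rewrite (xs_last (winch i x)) // ifF ?xs_last //; have := ltn_ord i; lia.
Qed.

Lemma winch_Skm i x : x \in Skm k m -> winch i x \in Skm k m.
Proof.
move=> Sx; apply/SkmP => j jk; rewrite !xs_winch // /winch_val.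
have h1 := @Skm_ltn x j j.+1 Sx; have h2 := @Skm_ltn x j.-1 j Sx.
have h3 := @Skm_ltn x j.+1 j.+2 Sx; have ik := ltn_ord i.
by do 2![case: eqP => ? /=]; try case: ifP; lia.
Qed.

(** Between fixed neighbours, the entry runs cyclically through the integers strictly between
    them. *)
Lemma winch_inj i : {in Skm k m &, injective (winch (m := m) i)}.
Proof.
move=> x y Sx Sy e; apply: xs_inj => j.
have E j' : xs (winch i x) j' = xs (winch i y) j' by rewrite e.
have N j' : j' != i.+1 -> xs x j' = xs y j'.
  by move=> ne; have := E j'; rewrite !xs_winch // (negPf ne).
case: (eqVneq j i.+1) => [->|]; last exact: N.
have := E i.+1; rewrite !xs_winch // eqxx /winch_val /=.
have := @Skm_ltn x i i.+1 Sx; have := @Skm_ltn x i.+1 i.+2 Sx.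
have := @Skm_ltn y i i.+1 Sy; have := @Skm_ltn y i.+1 i.+2 Sy.
have ik := ltn_ord i.
rewrite (N i) ?(N i.+2); try lia.
by do 2![case: ifP]; lia.
Qed.

(** * Composites of winches along a word of positions *)

Definition winches (s : seq 'I_k) x := foldl (fun y i => winch i y) x s.

Lemma winches_Skm s x : x \in Skm k m -> winches s x \in Skm k m.
Proof. by elim: s x => [|i s IH] x Sx //=; apply: IH; apply: winch_Skm. Qed.

Lemma winches_inj s : {in Skm k m &, injective (winches s)}.
Proof.
elim: s => [|i s IH] x y Sx Sy //= e.
by apply: (winch_inj (i := i)) => //; apply: IH => //; apply: winch_Skm.
Qed.

(* One-based positions, matching the indexing of [xs]. *)
Definition precedes (s : seq 'I_k) (j l : nat) :=
  let p := [seq (val i).+1 | i <- s] in index j p < index l p.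

(** Without repetition each coordinate changes at most once, so a neighbour is seen with its final
    value if it came earlier and its initial value otherwise. Positions outside the word, sentinels
    included, have index past its end and never change. *)
Lemma xs_winches s x : uniq s -> x \in Skm k m ->
  forall j, xs (winches s x) j =
  if j \in [seq (val i).+1 | i <- s] then
    winch_val (xs x j)
      (xs (if precedes s j.-1 j then winches s x else x) j.-1)
      (xs (if precedes s j.+1 j then winches s x else x) j.+1)
  else xs x j.
Proof.
move=> + Sx; elim/last_ind: s => [|s a IH] // + j.
rewrite rcons_uniq => /andP[aNs /IH{}IH].
have Sz := winches_Skm s Sx.
rewrite /precedes; set p := map _ s in IH *; rewrite map_rcons -/p.
have aNp : (val a).+1 \notin p by rewrite (mem_map (f := fun i : 'I_k => (val i).+1)) // => u v [/val_inj].
rewrite /winches foldl_rcons -/(winches s x); set z := winches s x in IH Sz *.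
rewrite xs_winch // mem_rcons inE -cats1.
have Nz l : l \notin p -> xs z l = xs x l by move=> lNp; rewrite IH (negPf lNp).
have W l : l != a.+1 -> xs (winch a z) l = xs z l by move=> ne; rewrite xs_winch // (negPf ne).
case: eqP => [->|/eqP ja] /=.
  have P l : l != a.+1 ->
    xs (if index l (p ++ [:: a.+1]) < index a.+1 (p ++ [:: a.+1]) then winch a z else x) l = xs z l.
    move=> la; rewrite !index_cat (negPf aNp) /= eqxx addn0.
    case: (boolP (l \in p)) => lp; first by rewrite index_mem lp W.
    by rewrite ltnNge leq_addr /= Nz.
  by rewrite Nz // !P //; lia.
case: ifP => [jp|/negbT/Nz //].
have P l :
  xs (if index l (p ++ [:: a.+1]) < index j p then winch a z else x) l =
  xs (if index l p < index j p then z else x) l.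
  rewrite index_cat; case: (boolP (l \in p)) => lp.
    have la : l != a.+1 by apply: contraNneq aNp => <-.
    by case: ifP => // _; rewrite W.
  have jl : index j p < size p by rewrite index_mem.
  have jlD n : (size p + n < index j p) = false by lia.
  by rewrite (memNindex lp) jlD ltnNge (ltnW jl).
by rewrite IH jp !(index_cat j) jp !P.
Qed.


(** * Delayed tuples for a word using every position once *)

Section Delay.
Variable s : seq 'I_k.
Hypotheses (s_uniq : uniq s) (s_full : forall i, i \in s).
Local Notation W := (winches s).

Lemma mem_positions j : (j \in [seq (val i).+1 | i <- s]) = (0 < j <= k).
Proof.
apply/mapP/idP => [[i _ ->]|/andP[j0 jk]]; first by rewrite ltn_ord.
by case: j j0 jk => // j _ jk; exists (Ordinal jk).
Qed.

Lemma precedesN j l : 0 < j <= k -> j != l -> precedes s l j = ~~ precedes s j l.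
Proof.
rewrite -mem_positions /precedes => jp jl; rewrite -leqNgt [RHS]leq_eqVlt.
set p := map _ _ in jp *; case: eqP => //= e; exfalso.
have lp : l \in p by rewrite -index_mem e index_mem.
by case/eqP: jl; rewrite -(nth_index 0 jp) -e nth_index.
Qed.

Lemma precedes0 j : precedes s 0 j = false.
Proof.
by rewrite /precedes ltnNge (@memNindex _ 0) ?index_size // mem_positions.
Qed.

Lemma xs_W x j : x \in Skm k m -> 0 < j <= k -> xs (W x) j =
  winch_val (xs x j) (xs (if precedes s j.-1 j then W x else x) j.-1)
    (xs (if precedes s j j.+1 then x else W x) j.+1).
Proof.
move=> Sx jk; rewrite {1}xs_winches // mem_positions jk.
by rewrite (@precedesN j j.+1) ?if_neg // neq_ltn leqnn.
Qed.

(** Position [j] moves while its right neighbour still has its old value, and remains below it;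
    induction covers a left neighbour that has already moved. This is the inequality between
    consecutive rounds that the delayed tuple requires. *)
Lemma W_ltn x j : x \in Skm k m -> 0 < j <= k -> precedes s j j.+1 ->
  xs (W x) j < xs x j.+1.
Proof.
move=> Sx; elim: j => // j IH jk pj; rewrite xs_W // pj /=.
have := @Skm_ltn x j j.+1 Sx; have := @Skm_ltn x j.+1 j.+2 Sx.
have : xs (if precedes s j j.+1 then W x else x) j < xs x j.+1.
  case: ifP => [pj'|_]; last by apply: Skm_ltn => //; lia.
  by apply: (IH _ pj'); case: (posnP j) pj' => [->|]; [rewrite precedes0|lia].
by move: (xs (if _ then _ else _) j) => L; rewrite /winch_val; case: ifP; lia.
Qed.

Lemma iter_W_Skm t x : x \in Skm k m -> iter t W x \in Skm k m.
Proof. by move=> Sx; elim: t => //= t; apply: winches_Skm. Qed.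

(* Reading coordinate [j] after [delay j] rounds makes [j + 1] always move just
   before [j], as if the winching order were k, ..., 1. *)
Definition delay (j : nat) : nat := \sum_(j <= l < k) precedes s l l.+1.

Definition delayed x : tup k m := [ffun i : 'I_k => iter (delay i.+1) W x i].

Lemma delayS j : j < k -> delay j = precedes s j j.+1 + delay j.+1.
Proof. by move=> jk; rewrite /delay big_ltn. Qed.

Lemma xs_delayed x j : xs (delayed x) j = xs (iter (delay j) W x) j.
Proof.
by elim/xs_ordP: j => [|i|j kj] //; rewrite ?xs_ord ?ffunE // !xs_last.
Qed.

Lemma xs_delayed_iter t x j :
  xs (delayed (iter t W x)) j = xs (iter (t + delay j) W x) j.
Proof. by rewrite xs_delayed addnC iterD. Qed.

(** Adjacent delays differ by at most one: equal delays compare entries of one tuple, and otherwise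
    [W_ltn] compares consecutive rounds. *)
Lemma delayed_Skm x : x \in Skm k m -> delayed x \in Skm k m.
Proof.
move=> Sx; apply/SkmP => j jk; rewrite !xs_delayed.
have S n := iter_W_Skm n Sx.
move: jk; rewrite leq_eqVlt => /orP[/eqP ->|jk].
  by rewrite (@xs_last _ k.+1) // -(@xs_last (iter (delay k) W x) k.+1) // Skm_ltn //; lia.
rewrite delayS //; case: (boolP (precedes _ _ _)) => pj; last by apply: Skm_ltn => //; lia.
rewrite add1n iterS W_ltn ?(ltnW jk) ?andbT //.
by case: (posnP j) pj => // ->; rewrite precedes0.
Qed.

(** The difference of adjacent delays cancels the choice of round in [xs_W], so the left neighbour
    is always old and the right one always new. *)
Lemma xs_delayed_W x j : x \in Skm k m -> 0 < j <= k ->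
  xs (delayed (W x)) j =
  winch_val (xs (delayed x) j) (xs (delayed x) j.-1) (xs (delayed (W x)) j.+1).
Proof.
move=> Sx jk; rewrite -[W x]/(iter 1 W x) !xs_delayed_iter !xs_delayed !add1n iterS.
rewrite xs_W ?iter_W_Skm //; congr winch_val.
  case: j jk => [|[|j]] // jk /=; rewrite (@delayS j.+1); last lia.
  by case: ifP.
case: (ltnP j k) => [jk'|jk']; last by rewrite !xs_last.
by rewrite (@delayS j) //; case: (precedes s j j.+1).
Qed.

(** Downward induction from [k]: an advanced right neighbour leaves room, while one reset to the
    current entry plus one blocks the move. *)
Lemma xs_delayed_rot x j : x \in Skm k m -> 0 < j <= k ->
  xs (delayed (W x)) j =
  if xs (delayed x) k < m then (xs (delayed x) j).+1
  else (xs (delayed x) j.-1).+1.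
Proof.
move=> Sx /andP[j0 jk]; have Sy := delayed_Skm Sx.
have [d dk] : {d | d = k - j} by exists (k - j).
have := Sy; move/SkmP => ltx; have xk := ltx k (leqnn k).
rewrite (@xs_last _ k.+1) // in xk.
elim: d j j0 jk dk => [|d IH] j j0 jk dk.
  have -> : j = k by lia.
  rewrite xs_delayed_W // ?(@xs_last _ k.+1) // /winch_val; lia.
rewrite xs_delayed_W ?j0 // IH; [|lia..].
by rewrite /winch_val /=; have := ltx j jk; do 2![case: ifP]; lia.
Qed.

Lemma iter_W_inj t : {in Skm k m &, injective (iter t W)}.
Proof.
elim: t => //= t IH x y Sx Sy e; apply: IH => //.
by apply: (winches_inj (s := s)); rewrite ?iter_W_Skm.
Qed.

Lemma delay_le j : delay j <= k.
Proof.
rewrite /delay; apply: leq_trans (_ : \sum_(j <= l < k) 1 <= k).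
  by apply: leq_sum => l _; case: precedes.
by rewrite sum_nat_const_nat muln1 leq_subr.
Qed.

Lemma delayed_W_congr x y : x \in Skm k m -> y \in Skm k m ->
  delayed x = delayed y -> delayed (W x) = delayed (W y).
Proof.
move=> Sx Sy e; apply: xs_inj; elim/xs_ordP => [|i|j kj] //; last by rewrite !xs_last.
by rewrite !xs_delayed_rot ?e ?ltn_ord.
Qed.

(** Equal delayed tuples stay equal in later rounds. Since delays are at most [k], every coordinate
    can then be compared in the common round [k], and injectivity of [W] leads back to round 0. *)
Lemma delayed_inj : {in Skm k m &, injective delayed}.
Proof.
move=> x y Sx Sy e.
have E t : delayed (iter t W x) = delayed (iter t W y).
  by elim: t => //= t; apply: delayed_W_congr; apply: iter_W_Skm.
apply: (@iter_W_inj k) => //; apply: xs_inj => j.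
by have := xs_delayed_iter (k - delay j) x j; rewrite E xs_delayed_iter subnK ?delay_le.
Qed.


(** * Conjugacy with rotation, and the period m *)

Lemma values_delayed_W x : 0 < k -> x \in Skm k m ->
  values (delayed (W x)) = rotm (values (delayed x)).
Proof.
move=> k0 Sx; have Sy := delayed_Skm Sx; have Sy' := delayed_Skm (winches_Skm s Sx).
apply/esym/eqP; rewrite eqEcard (card_imset _ (@ordS_inj m)) !card_values // leqnn andbT.
apply/subsetP => _ /imsetP[v + ->]; rewrite !inE => /existsP[i /eqP/= yi].
have yiv : xs (delayed x) i.+1 = v.+1 by rewrite xs_ord.
have ik := ltn_ord i; have vm := ltn_ord v; apply/existsP.
have rot (l : 'I_k) : val (delayed (W x) l) = xs (delayed (W x)) l.+1 by rewrite xs_ord.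
have := @Skm_ltn _ i.+1 k Sy; have := @Skm_ltn _ k k.+1 Sy.
rewrite (@xs_last _ k.+1) // yiv => ykm yik.
(* With top entry below [m], every value grows by one in its own position. *)
case: (ltnP (xs (delayed x) k) m) => yk.
  have vm1 : v.+1 < m.
    by move: ik; rewrite leq_eqVlt => /orP[/eqP e|ik]; [rewrite -yiv e|]; lia.
  exists i; rewrite rot xs_delayed_rot ?ltn_ord // yk yiv /=.
  by rewrite modn_small.
(* With top entry [m], that entry re-enters as 1 in the first position, the left sentinel plus one;
   any other value grows by one and moves one position right. *)
move: ik; rewrite leq_eqVlt => /orP[/eqP e|ik].
  have vE : v.+1 = m by rewrite -yiv e; rewrite e in yiv; lia.
  exists (Ordinal k0); rewrite rot xs_delayed_rot // ltnNge yk /=.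
  by rewrite vE modnn.
exists (Ordinal ik); rewrite rot xs_delayed_rot // ltnNge yk /= yiv.
by rewrite modn_small //; lia.
Qed.

Lemma values_delayed_iter t x : 0 < k -> x \in Skm k m ->
  values (delayed (iter t W x)) = iter t (@rotm m) (values (delayed x)).
Proof.
by move=> k0 Sx; elim: t => //= t <-; apply: values_delayed_W; rewrite ?iter_W_Skm.
Qed.

Lemma iter_W_period x : 0 < k -> x \in Skm k m -> iter m W x = x.
Proof.
move=> k0 Sx; apply: delayed_inj; rewrite ?iter_W_Skm //.
by apply: values_inj; rewrite ?delayed_Skm ?iter_W_Skm // values_delayed_iter // iter_rotm_period.
Qed.

Lemma imset_delayed : delayed @: Skm k m = Skm k m.
Proof.
apply/eqP; rewrite eqEcard card_in_imset ?leqnn ?andbT; last exact: delayed_inj.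
by apply/subsetP => _ /imsetP[x Sx ->]; apply: delayed_Skm.
Qed.

(** * Sums of indicators over a period *)

Section Sums.
Variable R : pzRingType.
Hypothesis k_gt0 : 0 < k.
Local Open Scope ring_scope.

Lemma sum_delayed (P : pred nat) i x : x \in Skm k m ->
  \sum_(t < m) (P (delayed (iter t W x) i))%:R = \sum_(t < m) (P (iter t W x i))%:R :> R.
Proof.
move=> Sx; rewrite -(sum_periodic_shift (g := fun t => (P (iter t W x i))%:R)
  (delay i.+1)) => [|t]; last by rewrite iterD iter_W_period.
by apply: eq_bigr => t _; rewrite -xs_ord xs_delayed_iter xs_ord.
Qed.

(** Periodicity allows a shift of the left sum by [j] rounds, after which [values_rot_rev] matches
    the delayed sums term by term. *)
Lemma sum_le_rev i j x : (j <= m)%N -> x \in Skm k m ->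
  \sum_(t < m) (iter t W x i <= j)%N%:R =
  \sum_(t < m) (m - j < iter t W x (rev_ord i))%N%:R :> R.
Proof.
move=> jm Sx; rewrite -(sum_delayed (fun c => c <= j)%N) //.
rewrite -(sum_delayed (fun c => m - j < c)%N) //.
rewrite -(sum_periodic_shift (g := fun t => (delayed (iter t W x) i <= j)%N%:R) j) => [|t].
  apply: eq_bigr => t _; rewrite -(@values_rot_rev _ _ _ (delayed (iter (t + j) W x))) //.
  - by rewrite delayed_Skm ?iter_W_Skm.
  - by rewrite delayed_Skm ?iter_W_Skm.
  by rewrite addnC iterD values_delayed_iter ?iter_W_Skm.
by rewrite iterD iter_W_period.
Qed.

(** An equality indicator is a difference of threshold indicators, for [j] and [j.-1], to which
    [sum_le_rev] applies. *)
Lemma sum_eq_rev i j x : (1 <= j <= m)%N -> x \in Skm k m ->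
  \sum_(t < m) (iter t W x i == j :> nat)%:R =
  \sum_(t < m) (iter t W x (rev_ord i) == m.+1 - j :> nat)%N%:R :> R.
Proof.
move=> /andP[j1 jm] Sx.
have diff (a b : bool) : (b -> a) -> (a && ~~ b)%:R = a%:R - b%:R :> R.
  by case: a b => -[] // h; rewrite ?subrr ?subr0 //; have := h isT.
have El (c : nat) : (c == j)%:R = (c <= j)%N%:R - (c <= j.-1)%N%:R :> R.
  by rewrite -diff; [congr (nat_of_bool _)%:R; lia | lia].
have Er (c : nat) : (c == m.+1 - j)%N%:R = (m - j < c)%N%:R - (m - j.-1 < c)%N%:R :> R.
  by rewrite -diff; [congr (nat_of_bool _)%:R; lia | lia].
under eq_bigr do rewrite El; under [RHS]eq_bigr do rewrite Er.
by rewrite !sumrB !sum_le_rev //; lia.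
Qed.

Lemma exists_sum j x : x \in Skm k m ->
  [exists i, val (x i) == j]%:R = \sum_i (val (x i) == j)%:R :> R.
Proof.
move=> Sx; case: existsP => [[i /eqP xi]|nx]; last first.
  by rewrite big1 // => i _; case: eqP => // xi; case: nx; exists i; apply/eqP.
rewrite (bigD1 i) //= -xi eqxx big1 ?addr0 // => l li.
by rewrite (inj_eq val_inj) (inj_eq (Skm_ord_inj Sx)) (negPf li).
Qed.

(** Splitting by position lets each coordinate take its own delay. Reassembled, the sum counts how
    often a rotating [k]-subset contains a given value. *)
Lemma sum_exists j x : (1 <= j <= m)%N -> x \in Skm k m ->
  \sum_(t < m) [exists i, val (iter t W x i) == j]%:R = k%:R :> R.
Proof.
case: j => // j jm Sx.
transitivity (#|values (delayed x)|%:R : R); last by rewrite card_values ?delayed_Skm.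
rewrite -(sum_iter_rotm R (Ordinal jm)).
under eq_bigr => t _ do rewrite exists_sum ?iter_W_Skm //.
rewrite exchange_big /=; under eq_bigr => i _ do rewrite -(sum_delayed (fun c => c == j.+1)) //.
rewrite exchange_big /=; apply: eq_bigr => t _.
by rewrite -values_delayed_iter // inE exists_sum ?delayed_Skm ?iter_W_Skm.
Qed.
End Sums.
End Delay.
End Coordinates.

(** * Assembly for an arbitrary permutation *)

Lemma Wnu_winches (k m : nat) (nu : 'S_k) :
  Wnu (m := m) nu =1 winches [seq nu t | t <- enum 'I_k].
Proof.
by move=> x; rewrite /Wnu /winches; elim: (enum 'I_k) x => //= t r IH x; apply: IH.
Qed.

Theorem mainTheorem5 (R : realFieldType) (k m : nat) (nu : 'S_k) :
  (1 <= k)%N -> (k <= m)%N ->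
  [/\ (* (1) *)
      (forall x, x \in Skm k m -> iter m (Wnu nu) x = x),
      (* (2) conjugacy with rotation of k-subsets of [m] *)
      (exists phi : tup k m -> {set 'I_m},
          [/\ {in Skm k m &, injective phi},
              phi @: Skm k m = ksubsets k m
            & forall x, x \in Skm k m -> phi (Wnu nu x) = rotm (phi x)]),
      (* (3) d_{i,j} are 0-mesic *)
      (forall (i : 'I_k) (j : nat), (1 <= j <= m)%N ->
          zero_mesic (Wnu nu) (Skm k m) (dfun R i j)),
      (* f_j homomesic with average k/m *)
      (forall j : nat, (1 <= j <= m)%N ->
          forall x, x \in Skm k m ->
            orbit_avg (Wnu nu) (ffn R j) x = (k%:R / m%:R)%R)
    & (* linear combinations *)
      (forall (a : 'I_k -> nat -> R) (b : nat -> R),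
          homomesic (Wnu nu) (Skm k m)
            (fun x => (\sum_(i < k) \sum_(1 <= j < m.+1) a i j * dfun R i j x
                       + \sum_(1 <= j < m.+1) b j * ffn R j x)%R))].
Proof.
move=> k0 km; have m0 : (0 < m)%N by apply: leq_trans k0 km.
pose s := [seq nu t | t <- enum 'I_k].
have s_uniq : uniq s by rewrite (map_inj_uniq perm_inj) enum_uniq.
have s_full i : i \in s by apply/mapP; exists ((nu^-1)%g i); rewrite ?mem_enum ?permKV.
have WE t : iter t (Wnu (m := m) nu) =1 iter t (winches s).
  exact/eq_iter/Wnu_winches.
have per x : x \in Skm k m -> iter m (Wnu nu) x = x.
  by move=> Sx; rewrite WE iter_W_period.
have d0 (i : 'I_k) (j : nat) : (1 <= j <= m)%N ->
    zero_mesic (Wnu nu) (Skm k m) (dfun R i j).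
  move=> jm x Sx; rewrite (orbit_avg_period _ m0 (per x Sx)) sumrB.
  rewrite /gfun; under eq_bigr do rewrite WE; rewrite (sum_eq_rev s_uniq s_full) //.
  by under [X in (_ - X)%R]eq_bigr do rewrite WE; rewrite subrr mul0r.
have fkm (j : nat) : (1 <= j <= m)%N -> forall x, x \in Skm k m ->
    orbit_avg (Wnu nu) (ffn R j) x = (k%:R / m%:R)%R.
  move=> jm x Sx; rewrite (orbit_avg_period _ m0 (per x Sx)).
  by under eq_bigr do rewrite WE; rewrite (sum_exists s_uniq s_full).
split=> //.
- exists (fun x => values (delayed s x)); split.
  + move=> x y Sx Sy /values_inj e; apply: (delayed_inj s_uniq s_full) => //.
    by apply: e; apply: delayed_Skm.
  + by rewrite (imset_comp (@values k m)) imset_delayed // imset_values.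
  + by move=> x Sx; rewrite Wnu_winches values_delayed_W.
(* By linearity the [dfun] terms average to 0 and each [ffn] term contributes its coefficient times
   k/m. *)
move=> a b; exists (\sum_(1 <= j < m.+1) b j * (k%:R / m%:R))%R => x Sx.
rewrite /orbit_avg big_split mulrDl /= exchange_big /= mulr_suml big1 ?add0r.
  rewrite exchange_big /= mulr_suml; apply: eq_big_nat => j jm.
  by rewrite -mulr_sumr -mulrA; congr (_ * _)%R; apply: fkm.
move=> i _; rewrite exchange_big /= mulr_suml big_nat big1 // => j jm.
by rewrite -mulr_sumr -mulrA [X in (_ * X)%R]d0 // mulr0.
Qed.
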